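(* Let $q\in\mathbb N_1$, $\theta>0$, and let $\nu$ be a Borel probability measure on $\Delta^{q-1}$ with $\nu(\mathring\Delta^{q-1})>0$. Let $(\mathscr A_t)_{t\in\mathbb N_0}$ be the polychromatic Hoppe chain with parameters $\theta,\nu$ started at $\mathscr A_0=0\in\mathcal A^{(q)}_0$, with law $P^0$. Then its one-dimensional time-marginals are $$P^0[\mathscr A_n=A]=\mathscr E^n_{\theta,\nu}[A],\qquad A\in\mathcal A^{(q)}_n,\ n\in\mathbb N_0.$$ Consequently $P^0[\mathscr A_m=B\mid\mathscr A_n=A]=S_{m,n}(A,B)$ for all $m\le n$, $A\in\mathcal A^{(q)}_n$, $B\in\mathcal A^{(q)}_m$; i.e., the polychromatic deletion chain (the reverse Markov chain with transition kernels $S_{m,n}$) is the time reversal of $(\mathscr A_t)_t$ under $P^0$.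
   Context: Notation: $\mathbb N_1=\{1,2,\dots\}$, $\mathbb N_0=\{0,1,\dots\}$, $[q]=\{1,\dots,q\}$, $\mathbb N^q_*=\mathbb N_0^q\setminus\{\mathbf 0\}$, $0^0=1$; $|\mathbf a|=\sum_ja_j$, $\mathbf u^{\mathbf a}=\prod_ju_j^{a_j}$, $\binom{|\mathbf a|}{\mathbf a}=|\mathbf a|!/\prod_ja_j!$; $\mathbf e_j$ canonical basis vectors; $\Delta^{q-1}=\{\mathbf u\in[0,1]^q:|\mathbf u|=1\}$ with relative interior $\mathring\Delta^{q-1}$; $\langle\theta\rangle_n=\theta(\theta+1)\cdots(\theta+n-1)$; $m_{\mathbf a}(\nu)=\int_{\Delta^{q-1}}\mathbf u^{\mathbf a}\,d\nu(\mathbf u)$ (all positive under the assumption on $\nu$). A $q$-chromatic partition of $n$ is a finitely supported map $A\colon\mathbb N^q_*\to\mathbb N_0$ with $\sum_{\mathbf a}A(\mathbf a)|\mathbf a|=n$; $\mathcal A^{(q)}_n$ is the set of these ($\mathcal A^{(q)}_0=\{0\}$), $\mathcal A^{(q)}_\cup=\bigcup_n\mathcal A^{(q)}_n$; $\mathbf 1_{\mathbf a}$ is the multiset with single element $\mathbf a$; operations pointwise. Deletion kernels: for $\mathbf a\in\mathrm{supp}A$, $a_j\ge1$, $A_{\setminus\mathbf a,j}=A-\mathbf 1_{\mathbf a}$ if $\mathbf a=\mathbf e_j$, else $A-\mathbf 1_{\mathbf a}+\mathbf 1_{\mathbf a-\mathbf e_j}$. $S_{n,n}(A,B)=1$ if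 $A=B$, else $0$; $S_{n-1,n}(A,B)=a_jA(\mathbf a)/n$ if $B=A_{\setminus\mathbf a,j}$, and $0$ otherwise; $S_{\ell,n}(A,C)=\sum_{B\in\mathcal A^{(q)}_m}S_{\ell,m}(B,C)S_{m,n}(A,B)$ for $\ell<m<n$. Polychromatic Hoppe chain: the Markov chain on $\mathcal A^{(q)}_\cup$ which from $B\in\mathcal A^{(q)}_m$ moves to $B+\mathbf 1_{\mathbf e_j}$ with probability $\frac{\theta\,m_{\mathbf e_j}(\nu)}{\theta+m}$, $j\in[q]$, and to $B-\mathbf 1_{\mathbf b}+\mathbf 1_{\mathbf b+\mathbf e_j}$ with probability $\frac{|\mathbf b|B(\mathbf b)}{\theta+m}\frac{m_{\mathbf b+\mathbf e_j}(\nu)}{m_{\mathbf b}(\nu)}$, $\mathbf b\in\mathrm{supp}B$, $j\in[q]$. Polychromatic Ewens Sampling Formula: $\mathscr E^n_{\theta,\nu}[A]=\frac{n!}{\langle\theta\rangle_n}\prod_{\mathbf a\in\mathrm{supp}A}\frac1{A(\mathbf a)!}\big(\frac{\theta}{|\mathbf a|}\binom{|\mathbf a|}{\mathbf a}m_{\mathbf a}(\nu)\big)^{A(\mathbf a)}$, $A\in\mathcal A^{(q)}_n$. *)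

(* Defs.v *)
From HB Require Import structures.
From mathcomp Require Import all_boot all_order all_algebra.
From mathcomp Require Import finmap multiset.
From mathcomp Require Import all_classical all_reals all_analysis.

Set Implicit Arguments.
Unset Strict Implicit.
Unset Printing Implicit Defensive.

Import Order.TTheory GRing.Theory Num.Theory.
Import numFieldNormedType.Exports.

Local Open Scope classical_set_scope.
Local Open Scope ring_scope.

Definition nvec (q : nat) := {ffun 'I_q -> nat}.

Definition nvec0 (q : nat) : nvec q := [ffun=> 0%N].

Definition vsize (q : nat) (a : nvec q) : nat := (\sum_j a j)%N.

Definition evec (q : nat) (j : 'I_q) : nvec q := [ffun i => (i == j : nat)].

Definition vadd (q : nat) (a b : nvec q) : nvec q := [ffun i => (a i + b i)%N].

Definition vsub (q : nat) (a b : nvec q) : nvec q := [ffun i => (a i - b i)%N].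

Lemma evec_neq0 (q : nat) (j : 'I_q) : evec j != nvec0 q.
Proof. by apply/eqP => /ffunP/(_ j); rewrite !ffunE eqxx. Qed.

Lemma vadd_evec_neq0 (q : nat) (b : nvec q) (j : 'I_q) :
  vadd b (evec j) != nvec0 q.
Proof. by apply/eqP => /ffunP/(_ j); rewrite !ffunE eqxx addn1. Qed.

Definition nzvec (q : nat) := {a : nvec q | a != nvec0 q}.

Definition nzunit (q : nat) (j : 'I_q) : nzvec q := Sub (evec j) (evec_neq0 j).

Definition nzincr (q : nat) (b : nzvec q) (j : 'I_q) : nzvec q :=
  Sub (vadd (val b) (evec j)) (vadd_evec_neq0 (val b) j).

(* [a - e_j]; it is only used when [a j > 0] and [a] is not [e_j], and then the
   default value of [insubd] is not reached, see [val_nzdecr]. *)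
Definition nzdecr (q : nat) (a : nzvec q) (j : 'I_q) : nzvec q :=
  insubd a (vsub (val a) (evec j)).

Lemma val_nzdecr (q : nat) (a : nzvec q) (j : 'I_q) :
  (0 < val a j)%N -> a != nzunit j -> val (nzdecr a j) = vsub (val a) (evec j).
Proof.
move=> aj aN; rewrite val_insubd ifT//; apply: contra_neq aN => /ffunP a0.
apply: val_inj; apply/ffunP => i /=; have := a0 i.
rewrite !ffunE; case: eqVneq => [->|_]; last by rewrite subn0.
by move=> /eqP; rewrite subn_eq0 => h; apply/eqP; rewrite eqn_leq h.
Qed.

(* The union over [n] of the [cpart_of q n] is the whole type [cpart q]. *)
Definition cpart (q : nat) := {mset (nzvec q)}%mset.

Definition cpart0 (q : nat) : cpart q := mset0.

Definition degree (q : nat) (A : cpart q) : nat :=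
  (\sum_(a <- finsupp A) A a * vsize (val a))%N.

Definition cpart_of (q n : nat) : set (cpart q) := [set A | degree A = n].

Arguments cpart_of : clear implicits.

Lemma finite_cpart_of (q n : nat) : finite_set (cpart_of q n).
Proof.
pose T := {ffun {ffun 'I_q -> 'I_n.+1} -> 'I_n.+1}.
pose f (A : cpart q) : T := [ffun v : {ffun 'I_q -> 'I_n.+1} =>
  inord (if insub [ffun i => val (v i)] is Some a then A a else 0%N)].
have vsize_gt0 (a : nzvec q) : (0 < vsize (val a))%N.
  rewrite lt0n; apply/negP => /eqP a0; move/eqP: (valP a); apply.
  apply/ffunP => i; rewrite ffunE; apply/eqP; rewrite -leqn0 -[X in (_ <= X)%N]a0.
  by rewrite /vsize (bigD1 i)//= leq_addr.
have bnd (A : cpart q) a : cpart_of q n A -> a \in finsupp A ->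
    (A a * vsize (val a) <= n)%N.
  by move=> <- aA; rewrite /degree (big_rem a)//= leq_addr.
have finj : set_inj (cpart_of q n) f.
  move=> A B; rewrite !inE => An Bn fAB; apply/msetP => a.
  have [abig|asmall] := boolP [forall i, val a i <= n]%N; last first.
    have outA (C : cpart q) : cpart_of q n C -> C a = 0%N.
      move=> Cn; apply/eqP; apply: contraNT asmall => Ca.
      have aC : a \in finsupp C by rewrite mem_finsupp.
      apply/forallP => i; apply: leq_trans (bnd _ _ Cn aC).
      rewrite (leq_trans _ (leq_pmull _ _)) ?lt0n//.
      by rewrite /vsize (bigD1 i)//= leq_addr.
    by rewrite (outA A)// (outA B).
  have Ale (C : cpart q) : cpart_of q n C -> (C a < n.+1)%N.
    move=> Cn; rewrite ltnS; have [aC|] := boolP (a \in finsupp C); last first.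
      by rewrite memNfinsupp => /eqP ->.
    exact: leq_trans (leq_pmulr _ (vsize_gt0 a)) (bnd _ _ Cn aC).
  have /ffunP/(_ [ffun i => inord (val a i)]) := fAB; rewrite !ffunE.
  have -> : [ffun i => val ([ffun i => inord (val a i)] i : 'I_n.+1)] = val a.
    by apply/ffunP => i; rewrite !ffunE /= inordK// ltnS; exact: (forallP abig).
  by rewrite valK => /(congr1 val) /=; rewrite !inordK ?Ale.
have fin : finite_set (f @` cpart_of q n) by exact: finite_finset.
by rewrite -(eq_finite_set (inj_card_eq finj)).
Qed.

Definition delete (q : nat) (A : cpart q) (a : nzvec q) (j : 'I_q) : cpart q :=
  if a == nzunit j then (A `\ a)%mset
  else (A `\ a `+` [mset (nzdecr a j)])%mset.

(* For a given [B] at most one pair [(a, j)] contributes, see [del1_delete]. *)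
Definition del1 (R : realType) (q n : nat) (A B : cpart q) : R :=
  \sum_(a <- finsupp A) \sum_(j < q | (0 < val a j)%N && (delete A a j == B))
    (val a j * A a)%:R / n%:R.

(* [deliter R m k] is the kernel from level [m + k] to level [m]. *)
Fixpoint deliter (R : realType) (q m k : nat) (A C : cpart q) {struct k} : R :=
  match k with
  | 0 => (A == C)%:R
  | k'.+1 =>
      if k' is 0 then del1 R m.+1 A C
      else \sum_(B \in cpart_of q (m + k'))
             deliter R m k' B C * del1 R (m + k'.+1) A B
  end.

(* Meant for [m <= n]. The composite kernels are obtained through the
   intermediate level [n.-1]; any other level between [m] and [n] gives the
   same kernel, see [delkerM]. *)
Definition delker (R : realType) (q m n : nat) (A C : cpart q) : R :=
  deliter R m (n - m) A C.

Lemma delete_inj (q : nat) (A : cpart q) (a b : nzvec q) (i j : 'I_q) :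
  a \in finsupp A -> b \in finsupp A -> (0 < val a i)%N -> (0 < val b j)%N ->
  delete A a i = delete A b j -> a = b /\ i = j.
Proof.
have decr_neq (c : nzvec q) k : (0 < val c k)%N -> c != nzunit k ->
    (c == nzdecr c k) = false.
  move=> ck cN; apply/eqP => /(congr1 val); rewrite val_nzdecr// => /ffunP/(_ k).
  by rewrite !ffunE eqxx => ckE; move: ck; rewrite -ltn_predL -subn1 -ckE ltnn.
rewrite !mem_finsupp -!lt0n => Aa Ab ai bj eqd.
have eqab : a = b.
  apply/eqP; apply: contraT => ab; have /msetP/(_ a) := eqd.
  have -> : delete A a i a = (A a).-1.
    rewrite /delete; case: eqVneq => [aE|aN]; rewrite !(msetE2, msetnE) eqxx ?subn1//.
    by rewrite decr_neq// addn0.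
  have : (A a <= delete A b j a)%N.
    by rewrite /delete; case: ifP => _; rewrite !(msetE2, msetnE) (negbTE ab) subn0 ?leq_addr.
  by move=> h e; move: h; rewrite -e -ltnS prednK// ltnn.
split=> //; rewrite -eqab in bj eqd.
have unit_lt (k l : 'I_q) : (0 < val (nzunit k) l)%N -> k = l.
  by rewrite /= ffunE; case: eqVneq.
have [aE|aNi] := eqVneq a (nzunit i).
  by rewrite aE in bj; exact: unit_lt.
have [aE|aNj] := eqVneq a (nzunit j).
  by rewrite aE in ai; rewrite (unit_lt _ _ ai).
have /eqP : nzdecr a i = nzdecr a j.
  apply/eqP; have /msetP/(_ (nzdecr a i)) := eqd.
  rewrite /delete (negbTE aNi) (negbTE aNj) !(msetE2, msetnE) eqxx => /addnI.
  by case: eqVneq.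
move=> /eqP /(congr1 val); rewrite !val_nzdecr// => /ffunP/(_ i).
rewrite !ffunE eqxx; case: (eqVneq i j) => // _; rewrite subn0 subn1 => e.
by move: ai; rewrite -ltn_predL e ltnn.
Qed.

Lemma del1_delete (R : realType) (q n : nat) (A : cpart q) (a : nzvec q)
    (j : 'I_q) : a \in finsupp A -> (0 < val a j)%N ->
  del1 R n A (delete A a j) = (val a j * A a)%:R / n%:R.
Proof.
move=> aA aj; rewrite /del1 (big_rem a)//= (bigD1 j) ?aj ?eqxx//=.
rewrite big1 ?addr0 => [|i /andP[/andP[ai /eqP e] /eqP]]; last first.
  by have [_ ->] := delete_inj aA aA ai aj e.
rewrite big_seq big1 ?addr0// => b.
rewrite mem_rem_uniq; last exact: fset_uniq.
rewrite inE => /andP[/eqP ba bA].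
by rewrite big1// => i /andP[bi /eqP e]; have [] := delete_inj bA aA bi aj e.
Qed.

Lemma del1_eq0 (R : realType) (q n : nat) (A B : cpart q) :
  (forall (a : nzvec q) (j : 'I_q), a \in finsupp A -> (0 < val a j)%N ->
    B <> delete A a j) -> del1 R n A B = 0.
Proof.
move=> BN; rewrite /del1 big_seq big1// => a aA; rewrite big1// => j.
by move=> /andP[aj /eqP e]; case: (BN a j).
Qed.

Lemma delkerM (R : realType) (q l m n : nat) (A C : cpart q) :
  (l < m)%N -> (m < n)%N ->
  delker R l n A C = \sum_(B \in cpart_of q m) delker R l m B C * delker R m n A B.
Proof.
move=> lm; move: A C; elim: n => // n IHn A C; rewrite ltnS leq_eqVlt.
have stepE k (A' C' : cpart q) : (k < n)%N -> delker R k n.+1 A' C' =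
    \sum_(B \in cpart_of q n) delker R k n B C' * del1 R n.+1 A' B.
  move=> kn; rewrite /delker subSn ?(ltnW kn)//.
  have : (0 < n - k)%N by rewrite subn_gt0.
  case E : (n - k)%N => [//|e] _; rewrite -[X in cpart_of q X](subnKC (ltnW kn)).
  rewrite [in RHS]E -[X in del1 R X](subnKC (leqW (ltnW kn))) subSn ?(ltnW kn)//.
  by rewrite E.
move=> /predU1P[mn|mn].
  rewrite stepE -?mn//; apply: eq_fsbigr => B _; congr (_ * _).
  by rewrite /delker subSnn.
rewrite stepE ?(ltn_trans lm)//.
under eq_fsbigr do rewrite IHn// mulr_fsuml.
rewrite exchange_fsbig; [|exact: finite_cpart_of..].
apply: eq_fsbigr => D _; rewrite stepE// mulr_fsumr.
by apply: eq_fsbigr => B _; rewrite mulrA.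
Qed.

Definition borel_rV (R : realType) (q : nat) :=
  g_sigma_algebraType (@open 'rV[R]_q).

Definition simplex (R : realType) (q : nat) : set 'rV[R]_q :=
  [set u | (forall j, 0 <= u 0 j <= 1) /\ \sum_j u 0 j = 1].

Arguments simplex : clear implicits.

Definition affine_hull (R : realType) (q : nat) (C : set 'rV[R]_q) :
    set 'rV[R]_q :=
  [set x | exists (n : nat) (l : 'I_n -> R) (y : 'I_n -> 'rV[R]_q),
    [/\ forall i, C (y i), \sum_i l i = 1 & x = \sum_i l i *: y i]].

Definition relint (R : realType) (q : nat) (C : set 'rV[R]_q) : set 'rV[R]_q :=
  [set x | C x /\ \forall y \near x, affine_hull C y -> C y].

(* A Borel measure on the simplex is represented by a Borel measure on R^q
   that is carried by the simplex. *)
Definition moment (R : realType) (q : nat) (nu : probability (borel_rV R q) R)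
    (a : nvec q) : R :=
  \int[nu]_(u in simplex R q) \prod_j (u 0 j) ^+ (a j).

(* The moves out of [B] have pairwise distinct targets, so that at most one
   summand is nonzero for a given [B'], see [hoppe_new] and [hoppe_old]. *)
Definition hoppe (R : realType) (q : nat) (theta : R)
    (nu : probability (borel_rV R q) R) (B B' : cpart q) : R :=
  \sum_(j < q | (B `+` [mset (nzunit j)])%mset == B')
    theta * moment nu (evec j) / (theta + (degree B)%:R)
  + \sum_(b <- finsupp B)
      \sum_(j < q | (B `\ b `+` [mset (nzincr b j)])%mset == B')
        (vsize (val b) * B b)%:R / (theta + (degree B)%:R)
        * (moment nu (val (nzincr b j)) / moment nu (val b)).

Lemma hoppe_sep (q : nat) (B C : cpart q) (b : nzvec q) (j : 'I_q) :
  b \in finsupp B -> (B b <= C b)%N ->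
  (B `\ b `+` [mset (nzincr b j)])%mset <> C.
Proof.
rewrite mem_finsupp -lt0n => Bb BC /msetP/(_ b).
rewrite !(msetE2, msetnE) eqxx ifF ?addn0 => [e|].
  by move: BC; rewrite -e subn1 leqNgt ltn_predL Bb.
apply/eqP => /(congr1 val) /= /ffunP/(_ j); rewrite !ffunE eqxx addn1.
by move=> /eqP; rewrite eqn_leq ltnn andbF.
Qed.

Lemma hoppe_new (R : realType) (q : nat) (theta : R)
    (nu : probability (borel_rV R q) R) (B : cpart q) (j : 'I_q) :
  hoppe theta nu B (B `+` [mset (nzunit j)])%mset
  = theta * moment nu (evec j) / (theta + (degree B)%:R).
Proof.
rewrite /hoppe [X in _ + X]big_seq [X in _ + X]big1 ?addr0 => [|b bB]; last first.
  rewrite big1// => i /eqP/hoppe_sep; case=> //.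
  by rewrite msetE2 leq_addr.
rewrite (bigD1 j) ?eqxx//= big1 ?addr0// => i /andP[/eqP/msetP/(_ (nzunit i)) e].
rewrite !(msetE2, msetnE) eqxx in e; move/addnI: e.
case: (eqVneq (nzunit i) (nzunit j)) => // /(congr1 val)/ffunP/(_ i).
by rewrite /= !ffunE eqxx; case: eqVneq.
Qed.

Lemma hoppe_old (R : realType) (q : nat) (theta : R)
    (nu : probability (borel_rV R q) R) (B : cpart q) (b : nzvec q) (j : 'I_q) :
  b \in finsupp B ->
  hoppe theta nu B (B `\ b `+` [mset (nzincr b j)])%mset
  = (vsize (val b) * B b)%:R / (theta + (degree B)%:R)
    * (moment nu (val (nzincr b j)) / moment nu (val b)).
Proof.
move=> bB; rewrite /hoppe [X in X + _]big1 ?add0r => [|i /eqP/esym/hoppe_sep]; last first.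
  by case=> //; rewrite msetE2 leq_addr.
rewrite (big_rem b)//= (bigD1 j) ?eqxx//= big1 ?addr0 => [|i /andP[/eqP/msetP]]; last first.
  move=> /(_ (nzincr b i)); rewrite !(msetE2, msetnE) eqxx => /addnI.
  case: (eqVneq (nzincr b i) (nzincr b j)) => // /(congr1 val)/ffunP/(_ i).
  rewrite /= !ffunE eqxx => /addnI.
  by case: eqVneq.
rewrite big_seq big1 ?addr0// => c; rewrite mem_rem_uniq; last exact: fset_uniq.
rewrite inE => /andP[cb cB]; rewrite big1// => i /eqP/hoppe_sep; case=> //.
by rewrite !(msetE2, msetnE) (negbTE cb) subn0 leq_addr.
Qed.

Definition rising (R : realType) (theta : R) (n : nat) : R :=
  \prod_(i < n) (theta + i%:R).

Definition multinomial (R : realType) (q : nat) (a : nvec q) : R :=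
  (vsize a)`!%:R / \prod_j (a j)`!%:R.

Definition esf (R : realType) (q : nat) (theta : R)
    (nu : probability (borel_rV R q) R) (n : nat) (A : cpart q) : R :=
  n`!%:R / rising theta n *
  \prod_(a <- finsupp A)
    ((A a)`!%:R^-1 *
     (theta / (vsize (val a))%:R * multinomial R (val a) * moment nu (val a))
       ^+ (A a)).

Definition cprob (R : realType) (d : measure_display) (Omega : measurableType d)
    (P : probability Omega R) (E F : set Omega) : R :=
  fine (P (E `&` F)) / fine (P F).

Definition markov_chain (R : realType) (d : measure_display)
    (Omega : measurableType d) (P : probability Omega R) (S : choiceType)
    (X : nat -> Omega -> S) (K : S -> S -> R) : Prop :=
  (forall t (U : set S), measurable (X t @^-1` U)) /\
  (forall t (x : nat -> S) (y : S),
    let past := [set w | forall s, (s <= t)%N -> X s w = x s] in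
    P past != 0%E ->
    cprob P [set w | X t.+1 w = y] past = K (x t) y).

(* [(X t)_t], read backwards in time from any [N], is a Markov chain whose
   transition kernel from time [n] to time [m <= n] is [K m n]. *)
Definition reverse_markov_chain (R : realType) (d : measure_display)
    (Omega : measurableType d) (P : probability Omega R) (S : choiceType)
    (X : nat -> Omega -> S) (K : nat -> nat -> S -> S -> R) : Prop :=
  forall (N m n : nat) (x : nat -> S) (y : S), (m <= n)%N -> (n <= N)%N ->
    let future := [set w | forall s, (n <= s <= N)%N -> X s w = x s] in
    P future != 0%E ->
    cprob P [set w | X m w = y] future = K m n (x n) y.

Definition hoppe_chain (R : realType) (q : nat) (theta : R)
    (nu : probability (borel_rV R q) R) (d : measure_display)
    (Omega : measurableType d) (P : probability Omega R)
    (X : nat -> Omega -> cpart q) : Prop :=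
  markov_chain P X (hoppe theta nu) /\ P [set w | X 0%N w = cpart0 q] = 1%E.

(* Main.v *)
Require Import Defs.
From mathcomp Require Import all_boot all_order all_algebra.
From mathcomp Require Import finmap multiset ring lra.
From mathcomp Require Import all_classical all_reals all_analysis measurable_realfun.

Import Order.TTheory GRing.Theory Num.Theory.
Import numFieldNormedType.Exports.

(** The idea is to guess the time reversal and to verify it by detailed balance.
    For partitions [A] of level [n + 1] and [B] of level [n],

      esf_n(B) * hoppe(B, A) = esf_(n+1)(A) * del1_(n+1)(A, B)        (esf_balance)

    Indeed, the growth chain passes from [B] to [A] exactly when [B] is obtained
    from [A] by a deletion, and then both partitions extend a common partition [C]
    by at most one box, so that the ratio of their probabilities is read off from
    the weights of the two boxes involved.

    Since the deletion kernel is stochastic ([sum_del1]), summing the balance over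
    [B] shows by induction that the sampling formula is the law of the chain at each
    time ([hoppe_marginal]). The balance then says that the probability flow between
    two consecutive times is given backwards by the deletion kernel, and the Markov
    property propagates this from two consecutive times to trajectories
    ([window_backward]); summing out the intermediate states produces the composite
    kernels ([hoppe_reverse]).

    Two facts are needed along the way. The moments are divided by, and the
    conditional probabilities are meaningful for every partition, because all
    moments are positive ([moment_gt0]): the relative interior of the simplex
    consists of its points with positive coordinates. And the Markov property, which
    conditions on the complete past, has to be transferred to windows of time that
    do not start at 0 ([window_forward]); the state space being countable, the
    forgotten part of the trajectory can be split according to its values. *)

Set Implicit Arguments.
Unset Strict Implicit.
Unset Printing Implicit Defensive.

Local Open Scope classical_set_scope.
Local Open Scope ring_scope.

(** * Adding one element to a multiset *)

Lemma finsupp_msetD1 (K : choiceType) (A : {mset K}%mset) (a : K) :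
  finsupp (A `+` [mset a])%mset = (a |` finsupp A)%fset.
Proof.
by apply/eqP/fset_eqP => x; rewrite !inE msuppE in_msetD in_mset1 orbC msuppE.
Qed.

(** The sampling formula is, up to a factor depending on the level only, of this
    form, with [w a] the factor contributed by one box of composition [a]. *)
Definition mset_weight (R : fieldType) (K : choiceType) (w : K -> R)
    (A : {mset K}%mset) : R :=
  \prod_(a <- finsupp A) ((A a)`!%:R^-1 * w a ^+ A a).

(** All the algebra of the detailed balance is here: a growth or a deletion
    step adds, removes or exchanges one element of a multiset, so applying this to
    the common part of the two partitions gives the ratio of their probabilities. *)
Lemma mset_weightD1 (R : numFieldType) (K : choiceType) (w : K -> R)
    (A : {mset K}%mset) (a : K) :
  mset_weight w (A `+` [mset a])%mset
  = mset_weight w A * (w a / (A a).+1%:R).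
Proof.
rewrite /mset_weight finsupp_msetD1.
have -> : \prod_(x <- finsupp A) ((A x)`!%:R^-1 * w x ^+ A x)
    = \prod_(x <- (a |` finsupp A)%fset) ((A x)`!%:R^-1 * w x ^+ A x).
  apply: big_fset_incl; first exact: fsubsetU1.
  by move=> x _; rewrite memNfinsupp => /eqP ->; rewrite invr1 mulr1.
rewrite (big_fsetD1 a) ?fset1U1//= [in RHS](big_fsetD1 a) ?fset1U1//=.
rewrite msetE2 msetnxx addn1 factS exprS natrM invfM.
rewrite (_ : \big[_/_]_(i <- _) _ =
  \prod_(x <- ((a |` finsupp A) `\ a)%fset) ((A x)`!%:R^-1 * w x ^+ A x)).
  by rewrite mulrACA -mulrA [LHS]mulrC [in X in _ * X]mulrC.
rewrite big_seq [RHS]big_seq; apply: eq_bigr => x.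
rewrite !inE => /andP[/negbTE xa _].
by rewrite msetE2 msetnE xa addn0.
Qed.

Lemma degreeD1 (q : nat) (A : cpart q) (a : nzvec q) :
  degree (A `+` [mset a])%mset = (degree A + vsize (val a))%N.
Proof.
rewrite /degree finsupp_msetD1.
have -> : (\sum_(x <- finsupp A) A x * vsize (val x))%N
    = (\sum_(x <- (a |` finsupp A)%fset) A x * vsize (val x))%N.
  apply: big_fset_incl; first exact: fsubsetU1.
  by move=> x _; rewrite memNfinsupp => /eqP ->; rewrite mul0n.
rewrite (big_fsetD1 a) ?fset1U1//= [in RHS](big_fsetD1 a) ?fset1U1//=.
rewrite msetE2 msetnxx mulnDl mul1n addnAC.
congr (_ + _ + _)%N; rewrite big_seq [RHS]big_seq; apply: eq_bigr => x.
by rewrite !inE => /andP[/negbTE xa _]; rewrite msetE2 msetnE xa addn0.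
Qed.

(** * Growth and deletion are inverse moves *)

Lemma vsize_evec (q : nat) (j : 'I_q) : vsize (evec j) = 1%N.
Proof.
rewrite /vsize (bigD1 j)//= ffunE eqxx big1// => i /negbTE ij.
by rewrite ffunE ij.
Qed.

Lemma vsize_vadd (q : nat) (a b : nvec q) :
  vsize (vadd a b) = (vsize a + vsize b)%N.
Proof. by rewrite /vsize -big_split; apply: eq_bigr => i _; rewrite ffunE. Qed.

Lemma vsize_gt0 (q : nat) (a : nzvec q) : (0 < vsize (val a))%N.
Proof.
rewrite lt0n; apply: contra_neq (valP a) => a0; apply/ffunP => i.
move: a0 => /eqP; rewrite /vsize sum_nat_eq0 => /forallP/(_ i)/eqP ->.
by rewrite ffunE.
Qed.

Lemma nzincr_nzdecr (q : nat) (a : nzvec q) (j : 'I_q) :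
  (0 < val a j)%N -> a != nzunit j -> nzincr (nzdecr a j) j = a.
Proof.
move=> aj aN; apply: val_inj; rewrite /= val_nzdecr//; apply/ffunP => i.
by rewrite !ffunE; case: eqVneq => [->|_]; [rewrite subnK|rewrite subn0 addn0].
Qed.

Lemma nzdecr_nzincr (q : nat) (b : nzvec q) (j : 'I_q) :
  nzdecr (nzincr b j) j = b.
Proof.
have [e|bN] := eqVneq (nzincr b j) (nzunit j).
  have /(congr1 (@vsize q)) := congr1 val e.
  rewrite /= vsize_vadd vsize_evec => /eqP.
  rewrite -[X in _ == X]add0n eqn_add2r => /eqP b0.
  by have := vsize_gt0 b; rewrite b0.
apply: val_inj; rewrite val_nzdecr//; last by rewrite !ffunE eqxx addn1.
by apply/ffunP => i; rewrite !ffunE addnK.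
Qed.

Lemma nzincr_neq_unit (q : nat) (b : nzvec q) (j i : 'I_q) :
  nzincr b j != nzunit i.
Proof.
apply/eqP => e; have /(congr1 (@vsize q)) := congr1 val e.
rewrite /= vsize_vadd !vsize_evec => /eqP.
rewrite -[X in _ == X]add0n eqn_add2r => /eqP b0.
by have := vsize_gt0 b; rewrite b0.
Qed.

Lemma msetBD1 (K : choiceType) (A : {mset K}%mset) (a : K) :
  a \in finsupp A -> (A `\ a `+` [mset a])%mset = A.
Proof. by rewrite msuppE msetDC; exact: msetB1K. Qed.

Lemma msetDB1 (K : choiceType) (A : {mset K}%mset) (a : K) :
  ((A `+` [mset a]) `\ a)%mset = A.
Proof. by rewrite msetDC; exact: msetD1K. Qed.

Lemma delete_unit (q : nat) (B : cpart q) (j : 'I_q) :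
  delete (B `+` [mset (nzunit j)])%mset (nzunit j) j = B.
Proof. by rewrite /delete eqxx msetDB1. Qed.

Lemma delete_incr (q : nat) (B : cpart q) (b : nzvec q) (j : 'I_q) :
  b \in finsupp B ->
  delete (B `\ b `+` [mset (nzincr b j)])%mset (nzincr b j) j = B.
Proof.
move=> bB.
by rewrite /delete (negbTE (nzincr_neq_unit b j j)) msetDB1 nzdecr_nzincr msetBD1.
Qed.

(** Every move of the growth chain is undone by a deletion ([delete_unit],
    [delete_incr]), so it leads from a deletion of its target. *)
Lemma hoppe_eq0 (R : realType) (q : nat) (theta : R)
    (nu : probability (borel_rV R q) R) (A B : cpart q) :
  (forall (a : nzvec q) (j : 'I_q), a \in finsupp A -> (0 < val a j)%N ->
    B <> delete A a j) -> hoppe theta nu B A = 0.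
Proof.
move=> BN; rewrite /hoppe big1 ?add0r => [|j /eqP e].
  rewrite big_seq big1// => b bB; rewrite big1// => j /eqP e.
  case: (BN (nzincr b j) j); rewrite -?e ?delete_incr//.
    by rewrite finsupp_msetD1 fset1U1.
  by rewrite !ffunE eqxx addn1.
case: (BN (nzunit j) j); rewrite -?e ?delete_unit//.
  by rewrite finsupp_msetD1 fset1U1.
by rewrite ffunE eqxx.
Qed.

Lemma degree_delete (q : nat) (A : cpart q) (a : nzvec q) (j : 'I_q) :
  a \in finsupp A -> (0 < val a j)%N -> degree A = (degree (delete A a j)).+1.
Proof.
move=> aA aj; rewrite -{1}(msetBD1 aA) degreeD1 /delete.
case: eqVneq => [->|aN]; first by rewrite vsize_evec addn1.
rewrite degreeD1 -{2}(nzincr_nzdecr aj aN) /= vsize_vadd vsize_evec.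
by rewrite addnA addn1.
Qed.

Lemma hoppe_degree (R : realType) (q : nat) (theta : R)
    (nu : probability (borel_rV R q) R) (A B : cpart q) :
  degree A != (degree B).+1 -> hoppe theta nu B A = 0.
Proof.
move=> dN; apply: hoppe_eq0 => a j aA aj BE.
by move: dN; rewrite (degree_delete aA aj) BE eqxx.
Qed.

Lemma del1_degree (R : realType) (q n : nat) (A B : cpart q) :
  degree A != (degree B).+1 -> del1 R n A B = 0.
Proof.
move=> dN; apply: del1_eq0 => a j aA aj BE.
by move: dN; rewrite (degree_delete aA aj) BE eqxx.
Qed.

(** Choosing a box [a] and a colour [j] with weight [a_j A(a)] amounts to choosing
    one of the [n + 1] coloured individuals uniformly, hence the total mass is 1. *)
Lemma sum_del1 (R : realType) (q n : nat) (A : cpart q) :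
  cpart_of q n.+1 A -> \sum_(B \in cpart_of q n) del1 R n.+1 A B = 1.
Proof.
move=> dA; have fin := finite_cpart_of q n.
rewrite fsbig_finite//= /del1 exchange_big/=.
transitivity (\sum_(a <- finsupp A) (A a * vsize (val a))%:R / n.+1%:R : R).
  rewrite big_seq [RHS]big_seq; apply: eq_bigr => a aA.
  rewrite (exchange_big_dep (fun j => 0 < val a j)%N)/= => [|? j _ /andP[]//].
  rewrite /vsize big_distrr/= natr_sum mulr_suml.
  rewrite [RHS](bigID (fun j => 0 < val a j)%N)/=.
  rewrite [X in _ = _ + X]big1 ?addr0 => [|j]; last first.
    by rewrite -eqn0Ngt => /eqP ->; rewrite muln0 mul0r.
  apply: eq_bigr => j aj; rewrite aj/=.
  rewrite big_mkcond (bigD1_seq (delete A a j)) ?fset_uniq//=; last first.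
    rewrite in_fset_set// inE; apply: succn_inj.
    by rewrite -(degree_delete aA aj).
  rewrite eqxx big1 ?addr0 1?mulnC// => B /negbTE BN.
  by rewrite eq_sym BN.
by rewrite -mulr_suml -natr_sum -/(degree A) dA divff ?pnatr_eq0.
Qed.

(** * Detailed balance *)

Lemma vfact_vadd (R : realType) (q : nat) (b : nvec q) (j : 'I_q) :
  \prod_i (vadd b (evec j) i)`!%:R = (b j).+1%:R * \prod_i (b i)`!%:R :> R.
Proof.
rewrite (bigD1 j)//= [in RHS](bigD1 j)//= mulrA -natrM -factS !ffunE eqxx addn1.
congr (_ * _); apply: eq_bigr => i /negbTE ij.
by rewrite !ffunE ij addn0.
Qed.

Definition type_weight (R : realType) (q : nat) (theta : R)
    (nu : probability (borel_rV R q) R) (a : nzvec q) : R :=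
  theta / (vsize (val a))%:R * multinomial R (val a) * moment nu (val a).

Lemma type_weight_unit (R : realType) (q : nat) (theta : R)
    (nu : probability (borel_rV R q) R) (j : 'I_q) :
  type_weight theta nu (nzunit j) = theta * moment nu (evec j).
Proof.
rewrite /type_weight /= /multinomial vsize_evec invr1 mulr1 big1 ?invr1 ?mulr1//.
by move=> i _; rewrite ffunE; case: eqP.
Qed.

(** The multinomial coefficients of [b + e_j] and [b] differ by the factor
    [(|b| + 1) / (b_j + 1)], and the denominators [|a|] of the sampling formula
    turn [|b| + 1] into [|b|]: this is the source of the size bias in the growth
    probability [|b| B(b)] and of the weight [a_j] in the deletion kernel. *)
Lemma type_weight_incr (R : realType) (q : nat) (theta : R)
    (nu : probability (borel_rV R q) R) (b : nzvec q) (j : 'I_q) :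
  moment nu (val b) != 0 ->
  type_weight theta nu (nzincr b j) * (val b j).+1%:R
  = type_weight theta nu b * (vsize (val b))%:R
    * (moment nu (val (nzincr b j)) / moment nu (val b)).
Proof.
move=> mb0; rewrite /type_weight /= /multinomial.
rewrite vfact_vadd vsize_vadd vsize_evec addn1 factS natrM.
have b0 : (vsize (val b))%:R != 0 :> R by rewrite pnatr_eq0 -lt0n vsize_gt0.
have P0 : \prod_i (val b i)`!%:R != 0 :> R.
  by apply/prodf_neq0 => i _; rewrite pnatr_eq0 -lt0n fact_gt0.
move: (\prod_i _) P0 => p P0.
have s0 n : n.+1%:R != 0 :> R by rewrite pnatr_eq0.
move: (s0 (val b j)) (s0 (vsize (val b))).
move: (val b j).+1%:R (vsize (val b)).+1%:R => x y x0 y0.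
by field; apply/and5P; split.
Qed.

Lemma esfE (R : realType) (q : nat) (theta : R)
    (nu : probability (borel_rV R q) R) (n : nat) (A : cpart q) :
  esf theta nu n A = n`!%:R / rising theta n * mset_weight (type_weight theta nu) A.
Proof. by []. Qed.

Lemma esf_gt0 (R : realType) (q : nat) (theta : R)
    (nu : probability (borel_rV R q) R) (n : nat) (A : cpart q) :
  0 < theta -> (forall a : nvec q, 0 < moment nu a) -> 0 < esf theta nu n A.
Proof.
move=> t0 moment_pos; rewrite /esf mulr_gt0//.
  rewrite divr_gt0 ?ltr0n ?fact_gt0//; apply: prodr_gt0 => i _.
  by rewrite ltr_pwDl.
apply: prodr_gt0 => a _; rewrite mulr_gt0 ?invr_gt0 ?ltr0n ?fact_gt0// exprn_gt0//.
rewrite !mulr_gt0 ?invr_gt0 ?ltr0n ?vsize_gt0 ?fact_gt0//.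
by apply: prodr_gt0 => i _; rewrite ltr0n fact_gt0.
Qed.

Lemma risingS (R : realType) (theta : R) (n : nat) :
  rising theta n.+1 = rising theta n * (theta + n%:R).
Proof. by rewrite /rising big_ord_recr. Qed.

(** Both sides can be written in terms of the part [C] that [A] and [B] share:
    [A] is [C] with a box [a] added, and [B] is [C] itself or [C] with the box
    [a - e_j] added. The weight of [C] then cancels, and what remains is the ratio
    of the weights of the boxes, [type_weight_unit] or [type_weight_incr]. *)
Lemma esf_balance (R : realType) (q : nat) (theta : R)
    (nu : probability (borel_rV R q) R) (n : nat) (A B : cpart q) :
  0 < theta -> (forall a : nvec q, 0 < moment nu a) -> degree B = n ->
  esf theta nu n B * hoppe theta nu B A = esf theta nu n.+1 A * del1 R n.+1 A B.
Proof.
move=> t0 moment_pos dB.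
(* When B is not a deletion of A, both kernels vanish. *)
have [[a [j [aA aj BE]]]|BN] := pselect (exists (a : nzvec q) (j : 'I_q),
    [/\ a \in finsupp A, (0 < val a j)%N & B = delete A a j]); last first.
  rewrite hoppe_eq0 ?del1_eq0 ?mulr0// => a j aA aj BE;
  by apply: BN; exists a, j.
have tn0 : theta + n%:R != 0 by rewrite gt_eqF// ltr_pwDl.
have r0 : rising theta n != 0.
  by apply/prodf_neq0 => i _; rewrite gt_eqF// ltr_pwDl.
have s0 k : k.+1%:R != 0 :> R by rewrite pnatr_eq0.
have -> : del1 R n.+1 A B = (val a j * A a)%:R / n.+1%:R by rewrite BE del1_delete.
have [C AE] : exists C : cpart q, A = (C `+` [mset a])%mset.
  by exists (A `\ a)%mset; rewrite msetBD1.
subst A; rewrite !esfE mset_weightD1 factS !natrM msetE2 msetnxx addn1.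
rewrite risingS.
have [aE|aN] := eqVneq a (nzunit j).
  subst a; rewrite delete_unit in BE; subst B.
  rewrite hoppe_new dB type_weight_unit /= ffunE eqxx [true%:R]mulr1n.
  move: (s0 n) (s0 (C (nzunit j))).
  move: (n.+1%:R) ((C (nzunit j)).+1%:R) => x y x0 y0.
  by field; apply/and4P; split.
pose b := nzdecr a j; have aE : a = nzincr b j by rewrite nzincr_nzdecr.
have {}BE : B = (C `+` [mset b])%mset by rewrite BE /delete (negbTE aN) msetDB1.
clearbody b; subst a B.
have -> : hoppe theta nu (C `+` [mset b])%mset (C `+` [mset (nzincr b j)])%mset
    = (vsize (val b) * (C b).+1)%:R / (theta + n%:R)
      * (moment nu (val (nzincr b j)) / moment nu (val b)).
  have := @hoppe_old R q theta nu (C `+` [mset b])%mset b j.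
  rewrite msetDB1 dB msetE2 msetnxx addn1; apply.
  by rewrite finsupp_msetD1 fset1U1.
rewrite natrM mset_weightD1.
have := type_weight_incr theta j (lt0r_neq0 (moment_pos (val b))).
have -> : val (nzincr b j) j = (val b j).+1 by rewrite /= !ffunE eqxx addn1.
move: (s0 n) (s0 (C (nzincr b j))) (s0 (C b)).
move: (n.+1%:R) ((C (nzincr b j)).+1%:R) ((C b).+1%:R) ((val b j).+1%:R).
move=> x y z t x0 y0 z0 wE.
transitivity (n`!%:R / rising theta n * mset_weight (type_weight theta nu) C
   / (theta + n%:R) * (type_weight theta nu (nzincr b j) * t)).
  rewrite wE; move: (moment_pos (val b)) => /lt0r_neq0.
  move: (moment nu (val b)) (moment nu (val (nzincr b j))) => u v u0.
  by field; apply/and4P; split.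
by field; apply/and4P; split.
Qed.

(** * Positivity of the moments *)

Lemma borel_continuous_measurable (R : realType) (q : nat) (f : 'rV[R]_q -> R) :
  continuous f -> measurable_fun setT (f : borel_rV R q -> R).
Proof.
move=> /continuousP cf; apply: (measurability _ (RGenOpens.measurableE R)).
move=> _ [_ [a [b ->] <-]]; rewrite setTI; apply: sub_sigma_algebra.
exact/cf/interval_open.
Qed.

Lemma monomial_measurable (R : realType) (q : nat) (a : nvec q)
    (D : set (borel_rV R q)) :
  measurable_fun D (fun u : borel_rV R q => \prod_j (u : 'rV[R]_q) 0 j ^+ a j).
Proof.
apply: measurable_funTS; apply: measurable_prod => j _.
apply: measurable_funX; apply: (@borel_continuous_measurable R q (fun u => u 0 j)).
exact: coord_continuous.
Qed.

Definition pos_coords (R : realType) (q : nat) : set 'rV[R]_q :=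
  [set u | forall j, 0 < u 0 j].

Lemma simplexE (R : realType) (q : nat) :
  simplex R q = [set u | forall j, 0 <= u 0 j] `&` [set u | \sum_j u 0 j = 1].
Proof.
apply/seteqP; split=> u [u01 u1]; split=> // j; first by have /andP[] := u01 j.
rewrite u01/= -u1 (bigD1 j)//= lerDl; apply: sumr_ge0 => i _; exact: u01.
Qed.

Lemma affine_hull_sum (R : realType) (q : nat) (u : 'rV[R]_q) :
  affine_hull (simplex R q) u -> \sum_j u 0 j = 1.
Proof.
move=> [n [l [y [Cy l1 ->]]]].
under eq_bigr do rewrite summxE.
rewrite exchange_big/= -l1; apply: eq_bigr => i _.
under eq_bigr do rewrite mxE.
by rewrite -mulr_sumr; case: (Cy i) => _ ->; rewrite mulr1.
Qed.

(** If [x] lies in the simplex and [x_j = 0], then moving slightly from [x] away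
    from the vertex [e_j] stays in the affine hull but makes the coordinate [j]
    negative, so that [x] is not relatively interior. Conversely, the affine
    hull lies in the hyperplane of sum 1, and there positivity of the coordinates
    is all that the simplex requires. *)
Lemma relint_simplex (R : realType) (q : nat) :
  relint (simplex R q) = simplex R q `&` @pos_coords R q.
Proof.
apply/seteqP; split=> x.
  move=> [Cx nx]; split; first exact: Cx.
  move=> j.
  have [xj01 x1] := Cx; have /andP[xj0 _] := xj01 j.
  rewrite lt_def xj0 andbT; apply/eqP => xj.
  pose e : 'rV[R]_q := \row_i (i == j)%:R.
  have Ce : simplex R q e.
    split=> [i|]; first by rewrite mxE; case: (i == j); rewrite ?lexx ?ler01.
    by rewrite (bigD1 j)//= mxE eqxx big1 ?addr0// => i /negbTE ij; rewrite mxE ij.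
  pose f (t : R) := x + t *: (x - e).
  have hull t : affine_hull (simplex R q) (f t).
    exists 2%N, (fun i => if i == 0 then 1 + t else - t),
      (fun i => if i == 0 then x else e).
    split=> [i||]; first by case: ifP.
      by rewrite big_ord_recl big_ord1/= addrK.
    by rewrite big_ord_recl big_ord1/= /f scalerDl scale1r scalerBr scaleNr addrA.
  have [r /= r0 xr] := (nbhs_ballP _ _).1 nx.
  (* Coordinates of points of the simplex differ by at most 1, so the step r / 2
     keeps f (r / 2) within distance r of x. *)
  have t0 : 0 < r / 2 by rewrite divr_gt0.
  have /xr/(_ (hull _))[ft _] : ball x r (f (r / 2)).
    split=> // k i; rewrite !mxE !ord1 /ball/=.
    rewrite opprD addNKr normrN normrM gtr0_norm//.
    have xe : `|x 0 i - e 0 i| <= 1.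
      have /andP[x0i xi1] := xj01 i; have [e01 _] := Ce.
      have /andP[e0i ei1] := e01 i.
      by rewrite ler_norml; lra.
    rewrite [e 0 i]mxE in xe.
    by apply: (le_lt_trans (ler_wpM2l (ltW t0) xe)); lra.
  have := ft j; rewrite !mxE eqxx xj [true%:R]mulr1n => /andP[+ _]; lra.
move=> [Cx xp]; split=> //.
have near_pos j : \forall y \near x, 0 < (y : 'rV[R]_q) 0 j.
  exact: (@coord_continuous R 1 q 0 j x _ (lt_nbhsr (xp j))).
have := filter_forall (nbhs_filter x) near_pos.
apply: filterS => y yp yh; rewrite simplexE; split; last exact: affine_hull_sum.
by move=> j; exact/ltW/yp.
Qed.

Lemma measurable_coordP (R : realType) (q : nat) (B : set R) : measurable B ->
  measurable ([set u | forall j, B (u 0 j)] : set (borel_rV R q)).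
Proof.
move=> mB.
have -> : ([set u | forall j, B (u 0 j)] : set (borel_rV R q)) =
    \bigcap_(j in [set: 'I_q])
      (fun u : borel_rV R q => (u : 'rV[R]_q) 0 j) @^-1` B.
  by apply/seteqP; split=> u h j; [move=> _; exact: h|exact: (h j I)].
apply: fin_bigcap_measurable => // j _; rewrite -[X in measurable X]setTI.
apply: (@borel_continuous_measurable R q (fun u => u 0 j)) => //.
exact: coord_continuous.
Qed.

Lemma measurable_simplex (R : realType) (q : nat) :
  measurable (simplex R q : set (borel_rV R q)).
Proof.
rewrite simplexE; apply: measurableI.
  have := @measurable_coordP R q `[0, +oo[%classic (measurable_itv _).
  congr measurable; apply/seteqP; split=> u h j; have := h j;
    by rewrite /= in_itv/= andbT.
rewrite -[X in measurable X]setTI.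
have msum : measurable_fun setT
    (fun u : borel_rV R q => \sum_j (u : 'rV[R]_q) 0 j).
  apply: measurable_sum => j.
  apply: (@borel_continuous_measurable R q (fun u => u 0 j)).
  exact: coord_continuous.
exact: (msum measurableT [set 1]).
Qed.

Lemma measurable_pos_coords (R : realType) (q : nat) :
  measurable (@pos_coords R q : set (borel_rV R q)).
Proof.
have := @measurable_coordP R q `]0, +oo[%classic (measurable_itv _).
congr measurable; apply/seteqP; split=> u h j; have := h j;
  by rewrite /= in_itv/= andbT.
Qed.

(** A null integral would force the monomial to vanish almost everywhere on the
    simplex, but it is positive on the relative interior. *)
Lemma moment_gt0 (R : realType) (q : nat) (nu : probability (borel_rV R q) R)
    (a : nvec q) :
  (0 < nu (relint (simplex R q)))%E -> 0 < moment nu a.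
Proof.
rewrite relint_simplex => nu_gt0.
have mS := @measurable_simplex R q.
have mI : measurable (simplex R q `&` @pos_coords R q : set (borel_rV R q)).
  exact: measurableI (@measurable_pos_coords R q).
pose f (u : borel_rV R q) : R := \prod_j (u : 'rV[R]_q) 0 j ^+ a j.
have mf D : measurable_fun D f by exact: monomial_measurable.
have f_ge0 u : simplex R q u -> 0 <= f u.
  by move=> [u01 _]; apply: prodr_ge0 => j _; apply: exprn_ge0;
    have /andP[] := u01 j.
have f_le1 u : simplex R q u -> f u <= 1.
  move=> [u01 _]; apply: prodr_ile1 => j _; have /andP[u0 u1] := u01 j.
  by rewrite exprn_ge0//= exprn_ile1.
rewrite /moment /Rintegral; apply: fine_gt0; apply/andP; split; last first.
  apply: (@le_lt_trans _ _ (\int[nu]_(u in simplex R q) (cst 1%:E) u)%E).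
    by apply: ge0_le_integral => //=; exact/measurable_EFinP.
  by rewrite integral_cst// mul1e (le_lt_trans (probability_le1 _ _))// ltry.
rewrite lt_def integral_ge0 ?andbT; last by move=> u Cu; rewrite lee_fin f_ge0.
apply/eqP => int0.
have : ae_eq nu (simplex R q) (EFin \o f) (cst 0%E).
  apply/(ae_eq_integral_abs nu mS) => //; first exact/measurable_EFinP.
  rewrite -[RHS]int0; apply: eq_integral => u; rewrite inE => Cu.
  by rewrite gee0_abs// lee_fin f_ge0.
move=> [N [mN N0 sN]].
suff : nu (simplex R q `&` @pos_coords R q) = 0%E.
  by move=> e; rewrite e ltxx in nu_gt0.
apply: (subset_measure0 _ _ _ N0) => // u [Cu up]; apply: sN => /(_ Cu)/= [fu].
have : 0 < f u by apply: prodr_gt0 => j _; apply: exprn_gt0; exact: up.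
by rewrite fu ltxx.
Qed.

(** * Processes with countable state space *)

(** Real-valued probabilities, so that ring identities apply. *)
Definition prob (R : realType) (d : measure_display) (Omega : measurableType d)
    (P : probability Omega R) (E : set Omega) : R := fine (P E).

Lemma probE (R : realType) (d : measure_display) (Omega : measurableType d)
    (P : probability Omega R) (E : set Omega) :
  measurable E -> P E = (prob P E)%:E.
Proof. by move=> mE; rewrite fineK// fin_num_measure. Qed.

Lemma prob_null_subset (R : realType) (d : measure_display) (Omega : measurableType d)
    (P : probability Omega R) (E F : set Omega) :
  measurable E -> measurable F -> E `<=` F -> prob P F = 0 -> prob P E = 0.
Proof.
move=> mE mF EF F0; have PF0 : P F = 0%E by rewrite probE// F0.
rewrite /prob (_ : P E = 0%E)//; exact: subset_measure0 mE mF EF PF0.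
Qed.

Definition measurable_process (d : measure_display) (Omega : measurableType d)
    (S : choiceType) (X : nat -> Omega -> S) : Prop :=
  forall t (U : set S), measurable (X t @^-1` U).

(** The law of total probability, in a form that never mentions an infinite sum:
    a proportionality of two events may be checked separately on each value of
    [X l]. With [c = 0] it says that an event is null as soon as it is null on
    each value of [X l]. *)
Lemma prob_atomwise (R : realType) (d : measure_display)
    (Omega : measurableType d) (P : probability Omega R) (S : choiceType)
    (X : nat -> Omega -> S) (l : nat) (E F : set Omega) (c : R) :
  countable [set: S] -> measurable_process X -> measurable E -> measurable F ->
  (forall z, prob P (E `&` [set w | X l w = z])
           = prob P (F `&` [set w | X l w = z]) * c) ->
  prob P E = prob P F * c.
Proof.
move=> /countable_injP[f finj] mX mE mF EF.
have mG G i : measurable G -> measurable (G `&` [set w | f (X l w) = i]).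
  by move=> mG; apply: measurableI => //; exact: (mX l [set z | f z = i]).
have split_level G : measurable G ->
    P G = (\sum_(i <oo) P (G `&` [set w | f (X l w) = i]))%E.
  move=> mG'; rewrite -measure_semi_bigcup//.
  - congr (P _); apply/seteqP; split=> [w Gw|w [i _ []]//].
    by exists (f (X l w)).
  - by move=> i; exact: mG.
  - apply/trivIsetP => i j _ _ ij; apply/seteqP; split=> // w.
    by move=> [[_ /= iE] [_ /= jE]]; move: ij; rewrite -iE jE eqxx.
  - by apply: bigcupT_measurable => i; exact: mG.
apply: EFin_inj; rewrite EFinM -!probE// muleC (split_level E)// (split_level F)//.
rewrite -nneseriesZl => [|i _]; last exact: measure_ge0.
apply: eq_eseriesr => i _.
(* The index i either codes a unique state z, or no state at all. *)
have [[z zi]|nz] := pselect (exists z, f z = i).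
  have eq_atom G : G `&` [set w | f (X l w) = i] = G `&` [set w | X l w = z].
    apply/seteqP; split=> w [Gw /=]; last by move=> ->.
    by rewrite -zi => e; split=> //; apply: finj; rewrite ?inE.
  rewrite !eq_atom.
  have mz G : measurable G -> measurable (G `&` [set w | X l w = z]).
    by move=> mG'; apply: measurableI => //; exact: (mX l [set z]).
  by rewrite !(probE P) ?EF ?EFinM 1?muleC//; exact: mz.
have empty_atom G : G `&` [set w | f (X l w) = i] = set0.
  by apply/seteqP; split=> // w [_ /= e]; case: nz; exists (X l w).
by rewrite !empty_atom measure0 mule0.
Qed.

Lemma prob_fsum (R : realType) (d : measure_display)
    (Omega : measurableType d) (P : probability Omega R) (S : choiceType)
    (X : nat -> Omega -> S) (l : nat) (E : set Omega) (F : set S) :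
  measurable_process X -> measurable E -> finite_set F ->
  prob P (X l @^-1` (~` F)) = 0 ->
  prob P E = \sum_(z \in F) prob P (E `&` [set w | X l w = z]).
Proof.
move=> mX mE finF nullF; apply: EFin_inj; rewrite -fsumEFin// -probE//.
have mz z : measurable (E `&` [set w | X l w = z]).
  by apply: measurableI => //; exact: (mX l [set z]).
under eq_fsbigr do rewrite -probE//.
rewrite -measure_fin_bigcup//; last first.
  apply/trivIsetP => i j _ _ ij; apply/seteqP; split=> // w.
  by move=> [[_ /= iE] [_ /= jE]]; move: ij; rewrite -iE jE eqxx.
have -> : \bigcup_(z in F) (E `&` [set w | X l w = z]) = E `&` X l @^-1` F.
  apply/seteqP; split=> [w [z Fz [Ew /= e]]|w [Ew Fw]]; last by exists (X l w).
  by split=> //=; rewrite e.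
have -> : P E = (P (E `\` X l @^-1` F) + P (E `&` X l @^-1` F))%E.
  exact: measureDI.
have mD : measurable (E `\` X l @^-1` F) by apply: measurableD => //; exact: mX.
by rewrite (probE P mD) (@prob_null_subset _ _ _ P _ (X l @^-1` ~` F)) ?add0e//; case.
Qed.

Definition window (Omega : Type) (S : Type) (X : nat -> Omega -> S)
    (l N : nat) (x : nat -> S) : set Omega :=
  [set w | forall s, (l <= s <= N)%N -> X s w = x s].

(** Changing a trajectory at one time: fixing in addition the value at time [l]
    turns a window starting at [l + 1] into one starting at [l], see [windowS]. *)
Definition upd (S : Type) (x : nat -> S) (l : nat) (z : S) : nat -> S :=
  fun s => if s == l then z else x s.

Lemma measurable_window (d : measure_display) (Omega : measurableType d)
    (S : choiceType) (X : nat -> Omega -> S) (l N : nat) (x : nat -> S) :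
  measurable_process X -> measurable (window X l N x).
Proof.
move=> mX; rewrite (_ : window X l N x =
    \bigcap_s (X s @^-1` [set z | (l <= s <= N)%N -> z = x s])).
  by apply: bigcapT_measurable => s; exact: mX.
by apply/seteqP; split=> w h; [move=> s _; exact: h|move=> s; exact: (h s I)].
Qed.

Lemma window1 (Omega : Type) (S : Type) (X : nat -> Omega -> S)
    (n : nat) (x : nat -> S) : window X n n x = [set w | X n w = x n].
Proof.
apply/seteqP; split=> w h; first by apply: h; rewrite leqnn.
by move=> s; rewrite -eqn_leq => /eqP <-.
Qed.

Lemma windowS (Omega : Type) (S : Type) (X : nat -> Omega -> S)
    (l N : nat) (x : nat -> S) (z : S) : (l <= N)%N ->
  window X l.+1 N x `&` [set w | X l w = z] = window X l N (upd x l z).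
Proof.
move=> lN; apply/seteqP; split=> w.
  move=> [h /= hz] s; rewrite /upd; case: eqVneq => [->//|sl] /andP[ls sN].
  by apply: h; rewrite sN andbT ltn_neqAle eq_sym sl.
move=> h; split=> [s /andP[ls sN]|].
  have := h s; rewrite /upd (gtn_eqF ls) (ltnW ls) sN; exact.
by have /= := h l; rewrite /upd eqxx leqnn lN; exact.
Qed.

Lemma eq_window (Omega : Type) (S : Type) (X : nat -> Omega -> S)
    (l N : nat) (x y : nat -> S) :
  (forall s, (l <= s)%N -> x s = y s) -> window X l N x = window X l N y.
Proof.
move=> xy; apply/seteqP; split=> w h s /andP[ls sN].
  by rewrite -xy// h// ls.
by rewrite xy// h// ls.
Qed.

Lemma upd_gt (S : Type) (x : nat -> S) (l s : nat) (z : S) :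
  (l < s)%N -> upd x l z s = x s.
Proof. by move=> ls; rewrite /upd gtn_eqF. Qed.

Lemma upd_eq (S : Type) (x : nat -> S) (l : nat) (z : S) : upd x l z l = z.
Proof. by rewrite /upd eqxx. Qed.

(** The Markov property conditions on the whole past from time 0; here the past is
    forgotten before time [l], one time after the other, by splitting according to
    the forgotten value: the transition probability does not depend on it. *)
Lemma window_forward (R : realType) (d : measure_display)
    (Omega : measurableType d) (P : probability Omega R) (S : choiceType)
    (X : nat -> Omega -> S) (K : S -> S -> R) (l N : nat) (x : nat -> S) :
  countable [set: S] -> markov_chain P X K -> (l <= N)%N ->
  prob P (window X l N.+1 x) = prob P (window X l N x) * K (x N) (x N.+1).
Proof.
move=> cS [mX chain]; elim: l x => [|l IHl] x lN.
  (* On null pasts the Markov property is silent, but then both sides are 0. *)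
  have [p0|p0] := eqVneq (P (window X 0 N x)) 0%E.
    rewrite {2}/prob p0 mul0r.
    apply: (@prob_null_subset _ _ _ P _ (window X 0 N x)); rewrite /prob ?p0//.
    - exact: measurable_window.
    - exact: measurable_window.
    - by move=> w h s sN; apply: h; rewrite leqW.
  have := chain N x (x N.+1) p0; rewrite /cprob => <-.
  rewrite mulrC divfK.
    congr (fine (P _)); apply/seteqP; split=> w.
      by move=> h; split=> [|s sN]; apply: h; rewrite ?leqnn ?leqW.
    move=> [e h] s /=; rewrite leq_eqVlt => /predU1P[->//|sN]; exact: h.
  by rewrite fine_eq0// fin_num_measure//;
    exact: (@measurable_window _ _ _ X 0 N x mX).
apply: (@prob_atomwise R d Omega P S X l) => //; try exact: measurable_window.
move=> z; rewrite !windowS ?(leqW (ltnW lN)) ?(ltnW lN)// IHl ?(ltnW lN)//.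
by rewrite !upd_gt// ltnW.
Qed.

Lemma prob_step (R : realType) (d : measure_display)
    (Omega : measurableType d) (P : probability Omega R) (S : choiceType)
    (X : nat -> Omega -> S) (K : S -> S -> R) (n : nat) (A B : S) :
  countable [set: S] -> markov_chain P X K ->
  prob P ([set w | X n.+1 w = A] `&` [set w | X n w = B])
  = prob P [set w | X n w = B] * K B A.
Proof.
move=> cS chain; have := window_forward (upd (fun=> A) n B) cS chain (leqnn n).
by rewrite -(windowS X (fun=> A) B (leqnSn n)) !window1 upd_eq upd_gt.
Qed.

(** Time reversal: when the one-dimensional laws satisfy the flow identity with
    respect to [Q], the probability of a trajectory can be peeled off from its
    earliest end, with transition probabilities [Q]. The flow identity treats the
    case of one step, and every later step multiplies both sides by the same
    forward transition probability. *)
Lemma window_backward (R : realType) (d : measure_display)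
    (Omega : measurableType d) (P : probability Omega R) (S : choiceType)
    (X : nat -> Omega -> S) (K : S -> S -> R) (Q : nat -> S -> S -> R)
    (l N : nat) (x : nat -> S) :
  countable [set: S] -> markov_chain P X K ->
  (forall t A B, prob P [set w | X t w = B] * K B A
               = prob P [set w | X t.+1 w = A] * Q t A B) ->
  (l < N)%N ->
  prob P (window X l N x) = prob P (window X l.+1 N x) * Q l (x l.+1) (x l).
Proof.
move=> cS chain balance; elim: N => // N IHN; rewrite ltnS leq_eqVlt.
case/predU1P=> [<-|lN].
  by rewrite (window_forward x cS chain)// !window1 balance.
by rewrite !(window_forward x cS chain) ?IHN ?(ltnW lN)// mulrAC.
Qed.

(** * The polychromatic Hoppe chain *)

Lemma countable_cpart (q : nat) : countable [set: cpart q].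
Proof.
have -> : [set: cpart q] = \bigcup_n cpart_of q n.
  by apply/seteqP; split=> // A _; exists (degree A).
apply: bigcup_countable => // n _; apply: finite_set_countable.
exact: finite_cpart_of.
Qed.

Lemma degree_eq0 (q : nat) (A : cpart q) : degree A = 0%N -> A = cpart0 q.
Proof.
move=> dA; apply/msetP => a; rewrite mset0E.
have [aA|] := boolP (a \in finsupp A); last by rewrite memNfinsupp => /eqP.
move: (msetBD1 aA) => AE; move: dA; rewrite -AE degreeD1 => /eqP.
by rewrite addn_eq0 andbC eqn0Ngt vsize_gt0.
Qed.

(** Each growth step adds exactly one individual, and the chain starts from the
    empty partition. *)
Lemma hoppe_degree_null (R : realType) (q : nat) (theta : R)
    (nu : probability (borel_rV R q) R) (d : measure_display)
    (Omega : measurableType d) (P : probability Omega R)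
    (X : nat -> Omega -> cpart q) (n : nat) (A : cpart q) :
  hoppe_chain theta nu P X -> degree A != n -> prob P [set w | X n w = A] = 0.
Proof.
move=> [chain X0]; have [mX _] := chain; elim: n A => [|n IHn] A dA.
  apply: (@prob_null_subset _ _ _ P _ (~` [set w | X 0%N w = cpart0 q])).
  - exact: (mX 0%N [set A]).
  - by apply: measurableC; exact: (mX 0%N [set cpart0 q]).
  - move=> w /= XA X0w; move: dA; rewrite -XA X0w /degree big1_fset// => a.
    by move=> _ _; rewrite mset0E.
  - by rewrite /prob probability_setC ?X0 ?subee//; exact: (mX 0%N [set cpart0 q]).
rewrite -[RHS](mulr0 (prob P [set w | X n.+1 w = A])).
apply: (@prob_atomwise _ _ _ P _ X n) => //; [exact: countable_cpart|..].
- exact: (mX n.+1 [set A]).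
- exact: (mX n.+1 [set A]).
move=> B; rewrite (prob_step n A B (countable_cpart q) chain) mulr0.
have [dB|dB] := eqVneq (degree B) n; last by rewrite IHn ?mul0r.
by rewrite hoppe_degree ?mulr0 ?dB.
Qed.

Lemma hoppe_support (R : realType) (q : nat) (theta : R)
    (nu : probability (borel_rV R q) R) (d : measure_display)
    (Omega : measurableType d) (P : probability Omega R)
    (X : nat -> Omega -> cpart q) (n : nat) :
  hoppe_chain theta nu P X -> prob P (X n @^-1` (~` cpart_of q n)) = 0.
Proof.
move=> hX; have [[mX _] _] := hX.
rewrite -[RHS](mulr0 (prob P setT)).
apply: (@prob_atomwise _ _ _ P _ X n) => //; first exact: countable_cpart.
move=> A; rewrite mulr0; have [dA|dA] := eqVneq (degree A) n.
  rewrite (_ : _ `&` _ = set0) ?/prob ?measure0//.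
  by apply/seteqP; split=> // w [/= XnN XA]; apply: XnN; rewrite XA.
apply: (@prob_null_subset _ _ _ P _ [set w | X n w = A]).
- by apply: measurableI => //; exact: (mX n [set A]).
- exact: (mX n [set A]).
- exact: subIsetr.
- exact: hoppe_degree_null hX dA.
Qed.

(** Summing the detailed balance over the possible states at time [n], the
    right-hand sides add up to the sampling formula at level [n + 1] because the
    deletion kernel has total mass 1. *)
Lemma hoppe_marginal (R : realType) (q : nat) (theta : R)
    (nu : probability (borel_rV R q) R) (d : measure_display)
    (Omega : measurableType d) (P : probability Omega R)
    (X : nat -> Omega -> cpart q) (n : nat) (A : cpart q) :
  0 < theta -> (forall a : nvec q, 0 < moment nu a) ->
  hoppe_chain theta nu P X -> degree A = n ->
  prob P [set w | X n w = A] = esf theta nu n A.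
Proof.
move=> theta0 moment_pos hX; have [chain X0] := hX; have [mX _] := chain.
elim: n A => [|n IHn] A dA.
  rewrite (degree_eq0 dA) /prob X0 /esf /rising big_ord0 big1_fset; last first.
    by move=> a _ _; rewrite mset0E invr1 mulr1.
  by rewrite fact0 divr1 mulr1.
rewrite (prob_fsum mX (mX n.+1 [set A]) (finite_cpart_of q n)
  (hoppe_support n hX)).
rewrite -[RHS]mulr1 -(sum_del1 R dA) mulr_fsumr.
apply: eq_fsbigr => B; rewrite inE => dB.
rewrite (prob_step n A B (countable_cpart q) chain) IHn//.
exact: esf_balance.
Qed.

(** Off the levels where the chain lives both sides vanish, so the flow identity
    holds for all pairs of states, as [window_backward] demands. *)
Lemma hoppe_balance (R : realType) (q : nat) (theta : R)
    (nu : probability (borel_rV R q) R) (d : measure_display)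
    (Omega : measurableType d) (P : probability Omega R)
    (X : nat -> Omega -> cpart q) (n : nat) (A B : cpart q) :
  0 < theta -> (forall a : nvec q, 0 < moment nu a) ->
  hoppe_chain theta nu P X ->
  prob P [set w | X n w = B] * hoppe theta nu B A
  = prob P [set w | X n.+1 w = A] * del1 R n.+1 A B.
Proof.
move=> theta0 moment_pos hX.
have [dAB|dAB] := eqVneq (degree A) (degree B).+1; last first.
  by rewrite hoppe_degree// del1_degree// !mulr0.
have [dB|dB] := eqVneq (degree B) n; last first.
  by rewrite !(hoppe_degree_null hX) ?dAB ?mul0r.
rewrite !(hoppe_marginal theta0 moment_pos hX) ?dAB ?dB//.
exact: esf_balance.
Qed.

(** The recursion on [k] follows the definition of [deliter]: the state at the
    level just below the window is summed out, and the part of the trajectory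
    starting there is handled by the previous case. *)
Lemma hoppe_reverse (R : realType) (q : nat) (theta : R)
    (nu : probability (borel_rV R q) R) (d : measure_display)
    (Omega : measurableType d) (P : probability Omega R)
    (X : nat -> Omega -> cpart q) (m k N : nat) (x : nat -> cpart q)
    (y : cpart q) :
  0 < theta -> (forall a : nvec q, 0 < moment nu a) ->
  hoppe_chain theta nu P X -> (m + k <= N)%N ->
  prob P (window X (m + k) N x `&` [set w | X m w = y])
  = prob P (window X (m + k) N x) * deliter R m k (x (m + k)%N) y.
Proof.
move=> theta0 moment_pos hX; have [chain X0] := hX; have [mX _] := chain.
have backward l z : (l < N)%N -> prob P (window X l N z)
    = prob P (window X l.+1 N z) * del1 R l.+1 (z l.+1) (z l).
  apply: (@window_backward _ _ _ P _ X _ (fun t => del1 R t.+1) l N z _ chain).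
    exact: countable_cpart.
  by move=> t A B; exact: hoppe_balance.
have eq_upd l z B : window X l.+1 N (upd z l B) = window X l.+1 N z.
  by apply: eq_window => s ls; rewrite upd_gt.
elim: k x => [|[_|k IHk]] x.
- rewrite addn0 => mN /=; have [xy|xy] := eqVneq (x m) y.
    rewrite mulr1; congr prob; apply/setIidPl => w h /=; rewrite -xy.
    by apply: h; rewrite leqnn.
  rewrite mulr0 (_ : _ `&` _ = set0) ?/prob ?measure0//.
  apply/seteqP; split=> // w [h /= XB]; move: xy; rewrite -XB h ?eqxx//.
  by rewrite leqnn.
- rewrite addn1 => mN; rewrite windowS ?(ltnW mN)// backward// eq_upd.
  by rewrite upd_gt// upd_eq.
rewrite addnS => nN; set n := (m + k.+1)%N in nN *.
rewrite (prob_fsum (l := n) mX _ (finite_cpart_of q n) (hoppe_support n hX));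
  last first.
  by apply: measurableI; [exact: measurable_window|exact: (mX m [set y])].
rewrite [deliter _ _ _ _ _]/= -/n mulr_fsumr; apply: eq_fsbigr => B _.
rewrite setIAC windowS ?(ltnW nN)// IHk ?(ltnW nN)// -/n backward// eq_upd.
by rewrite upd_gt// upd_eq -mulrA; congr (_ * _); rewrite mulrC addnS.
Qed.

Theorem corollary4p24 (R : realType) (q : nat) (hq : (1 <= q)%N)
    (theta : R) (htheta : 0 < theta)
    (nu : probability (borel_rV R q) R)
    (hnu : nu (simplex R q) = 1%E)
    (hnu_int : (0 < nu (relint (simplex R q)))%E)
    (d : measure_display) (Omega : measurableType d) (P : probability Omega R)
    (X : nat -> Omega -> cpart q) (hX : hoppe_chain theta nu P X) :
  (forall (n : nat) (A : cpart q), cpart_of q n A ->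
    P [set w | X n w = A] = (esf theta nu n A)%:E) /\
  (forall (m n : nat) (A B : cpart q), (m <= n)%N ->
    cpart_of q n A -> cpart_of q m B ->
    cprob P [set w | X m w = B] [set w | X n w = A] = delker R m n A B) /\
  reverse_markov_chain P X (delker R (q := q)).
Proof.
have moment_pos a : 0 < moment nu a by exact: moment_gt0.
have [[mX _] _] := hX.
have marginal n A : cpart_of q n A ->
    P [set w | X n w = A] = (esf theta nu n A)%:E.
  move=> dA; rewrite -(hoppe_marginal htheta moment_pos hX dA); apply: probE.
  exact: (mX n [set A]).
have reversal : reverse_markov_chain P X (delker R (q := q)).
  move=> N m n x y mn nN future F0.
  have mF : measurable future by exact: measurable_window.
  have := @hoppe_reverse _ _ _ _ _ _ _ X m (n - m) N x y htheta moment_pos hX.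
  rewrite subnKC// => /(_ nN) FE.
  rewrite /cprob setIC -/(prob P _) FE -/(prob P future) -/(delker R m n _ _).
  by rewrite mulrC mulKf// fine_eq0// fin_num_measure.
split=> //; split=> // m n A B mn dA dB.
have := reversal n m n (fun=> A) B mn (leqnn n).
rewrite -[[set w | forall s, _]]/(window X n n (fun=> A)) window1; apply.
by rewrite marginal// eqe gt_eqF// esf_gt0.
Qed.
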